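(* Let $(X,\tau,E)$ be a soft topological space over $X$ and let $(F,E)$ and $(G,E)$ be soft open sets over $X$. Then: (1) $\big((F,E)\setminus \mathrm{int}^s(G,E)\big)\subseteq (F,E)^{\circ}\setminus \mathrm{int}^s(G,E)$; (2) $\mathrm{bd}^s(\mathrm{int}^s(F,E))\subseteq \mathrm{bd}^s(F,E)$.
   Context: Let $X$ be a universe and $E$ a nonempty set of parameters. A soft set $(F,E)$ over $X$ is a mapping $F:E\to P(X)$, where $P(X)$ is the power set of $X$. Inclusion $(F,E)\subseteq(G,E)$, union, intersection and difference $\setminus$ of soft sets are taken parameterwise (e.g. $(F,E)\subseteq(G,E)$ iff $F(e)\subseteq G(e)$ for all $e\in E$). $\Phi$ is the soft set with value $\emptyset$ at every parameter and $\widetilde X$ the soft set with value $X$ at every parameter. The relative complement is $(F,E)'=(F',E)$, $F'(e)=X\setminus F(e)$. A soft topology on $X$ is a collection $\tau$ of soft sets $(F,E)$ over $X$ containing $\Phi$ and $\widetilde X$, closed under arbitrary unions and under intersections of two members; $(X,\tau,E)$ is then a soft topological space over $X$. Members of $\tau$ are soft open; $(F,E)$ is soft closed if $(F,E)'\in\tau$. The soft interior $(F,E)^{\circ}$ is the union of all soft open sets contained in $(F,E)$; the soft closure $\overline{(F,E)}$ is the intersection of all soft closed sets containing $(F,E)$. A soft set $(F,E)$ is soft semi-open if there is a soft open set $(G,E)$ with $(G,E)\subseteq(F,E)\subseteq\overline{(G,E)}$. The soft semi-interior $\mathrm{int}^s(F,E)$ is the union of all soft semi-open sets contained in $(F,E)$;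 the soft semi-exterior is $\mathrm{ext}^s(F,E)=\mathrm{int}^s((F,E)')$; the soft semi-boundary is $\mathrm{bd}^s(F,E)=(\mathrm{int}^s(F,E)\cup \mathrm{ext}^s(F,E))'$. *)

(* Defs.v *)
From mathcomp Require Import all_boot.
From mathcomp Require Import classical_sets.

Set Implicit Arguments.
Unset Strict Implicit.
Unset Printing Implicit Defensive.

Local Open Scope classical_set_scope.

Definition soft_set (X E : Type) : Type := E -> set X.

Section SoftSets.
Variables X E : Type.
Implicit Types (F G : soft_set X E) (S : set (soft_set X E)).

Definition soft_empty : soft_set X E := fun _ => set0.
Definition soft_full : soft_set X E := fun _ => setT.

Definition soft_subset F G : Prop := forall e, F e `<=` G e.
Definition soft_union F G : soft_set X E := fun e => F e `|` G e.
Definition soft_inter F G : soft_set X E := fun e => F e `&` G e.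
Definition soft_diff F G : soft_set X E := fun e => F e `\` G e.
Definition soft_compl F : soft_set X E := fun e => ~` F e.

Definition soft_bigcup S : soft_set X E := fun e => \bigcup_(F in S) F e.
Definition soft_bigcap S : soft_set X E := fun e => \bigcap_(F in S) F e.

Record is_soft_topology (tau : set (soft_set X E)) : Prop := IsSoftTopology {
  soft_topology_empty : tau soft_empty;
  soft_topology_full : tau soft_full;
  soft_topology_bigcup : forall S, S `<=` tau -> tau (soft_bigcup S);
  soft_topology_inter : forall F G, tau F -> tau G -> tau (soft_inter F G)
}.

Variable tau : set (soft_set X E).

Definition soft_open F : Prop := tau F.
Definition soft_closed F : Prop := tau (soft_compl F).

Definition soft_interior F : soft_set X E :=
  soft_bigcup [set G | soft_open G /\ soft_subset G F].
Definition soft_closure F : soft_set X E :=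
  soft_bigcap [set G | soft_closed G /\ soft_subset F G].

Definition soft_semi_open F : Prop :=
  exists G, [/\ soft_open G, soft_subset G F & soft_subset F (soft_closure G)].

Definition soft_semi_interior F : soft_set X E :=
  soft_bigcup [set G | soft_semi_open G /\ soft_subset G F].
Definition soft_semi_exterior F : soft_set X E :=
  soft_semi_interior (soft_compl F).
Definition soft_semi_boundary F : soft_set X E :=
  soft_compl (soft_union (soft_semi_interior F) (soft_semi_exterior F)).

End SoftSets.

(* Main.v *)
Require Import Defs.
From mathcomp Require Import all_boot.
From mathcomp Require Import classical_sets.

(** Both inclusions are formal. For (1), an open [F] is one of the sets whose
    union is its interior, so passing to the interior loses no point. For (2),
    the semi-interior is a monotone, contractive and idempotent operator, being
    a union of the members of a fixed family that lie below its argument.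
    Replacing [F] by its semi-interior therefore keeps the semi-interior, and,
    as the set shrinks, its complement and hence the semi-exterior grow; the
    semi-boundary, which is what these two leave over, shrinks. *)

Set Implicit Arguments.
Unset Strict Implicit.
Unset Printing Implicit Defensive.

Lemma soft_open_sub_interior (X E : Type) (tau : set (soft_set X E))
    (F : soft_set X E) :
  soft_open tau F -> soft_subset F (soft_interior tau F).
Proof. by move=> F_open e x Fx; exists F => //; split=> // e' y. Qed.

Lemma soft_semi_interior_sub (X E : Type) (tau : set (soft_set X E))
    (F : soft_set X E) :
  soft_subset (soft_semi_interior tau F) F.
Proof. by move=> e x [H [_ HF] Hx]; exact: HF Hx. Qed.

Lemma soft_semi_interior_mono (X E : Type) (tau : set (soft_set X E))
    (F G : soft_set X E) :
  soft_subset F G ->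
  soft_subset (soft_semi_interior tau F) (soft_semi_interior tau G).
Proof.
move=> FG e x [H [H_semi HF] Hx]; exists H => //; split=> // e' y Hy.
exact: FG (HF _ _ Hy).
Qed.

(** A semi-open set inside [F] is a member of the union defining the
    semi-interior of [F], hence lies inside it and takes part in the second
    union as well. *)
Lemma soft_semi_interior_sub_idem (X E : Type) (tau : set (soft_set X E))
    (F : soft_set X E) :
  soft_subset (soft_semi_interior tau F)
              (soft_semi_interior tau (soft_semi_interior tau F)).
Proof.
move=> e x [H [H_semi HF] Hx]; exists H => //; split=> // e' y Hy.
by exists H.
Qed.

Lemma soft_semi_boundary_interior_sub (X E : Type) (tau : set (soft_set X E))
    (F : soft_set X E) :
  soft_subset (soft_semi_boundary tau (soft_semi_interior tau F))
              (soft_semi_boundary tau F).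
Proof.
move=> e x bd_x [int_x | ext_x]; apply: bd_x.
  by left; exact: soft_semi_interior_sub_idem.
right; apply: soft_semi_interior_mono ext_x => e' y nFy int_y.
by apply: nFy; exact: soft_semi_interior_sub int_y.
Qed.

Theorem theorem3p19 (X E : Type) (E_nonempty : inhabited E)
    (tau : set (soft_set X E)) (tau_top : is_soft_topology tau)
    (F G : soft_set X E) (F_open : soft_open tau F) (G_open : soft_open tau G) :
  soft_subset (soft_diff F (soft_semi_interior tau G))
              (soft_diff (soft_interior tau F) (soft_semi_interior tau G)) /\
  soft_subset (soft_semi_boundary tau (soft_semi_interior tau F))
              (soft_semi_boundary tau F).
Proof.
split; last exact: soft_semi_boundary_interior_sub.
by move=> e x [Fx nGx]; split=> //; exact: soft_open_sub_interior.
Qed.
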